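(* Let $A$ be a tame commutative $\nu$-semiring, let $X=\operatorname{Spec}(A)$ with its Zariski topology, and let $Y\subset X$ be a closed subset. Then $Y$ is irreducible if and only if $\mathcal K(Y):=\bigcap_{\mathfrak P\in Y}\mathfrak P$ is a $\mathfrak g$-prime congruence.
   Context: An additive $\nu$-monoid is a triple $(M,\mathcal G,\nu)$, where $M$ is an additive abelian monoid with identity $0$, $\mathcal G\subseteq M$ is a distinguished partially ordered submonoid with $0<a$ for $0\neq a\in\mathcal G$, and $\nu:M\to\mathcal G$ is an idempotent monoid homomorphism (a projection onto $\mathcal G$), such that for all $a,b\in M$: (NM1) $a+b=a$ whenever $\nu(a)>\nu(b)$; (NM2) $a+b=\nu(a)$ whenever $\nu(a)=\nu(b)$; (NM3) if $a+b\notin\mathcal G$ and $a+\nu(b)\in\mathcal G$ then $a+b=\nu(a)+b$. Write $a^\nu=\nu(a)$; elements of $\mathcal G$ are called ghosts. A sum $a+b$ is redundant if $a+b=a$ or $a+b=b$. A commutative $\nu$-semiring is $A=(A,\mathcal T,\mathcal G,\nu)$, where $A$ is a commutative unital semiring with absorbing $0$, its additive monoid with $\mathcal G,\nu$ is an additive $\nu$-monoid, and $\mathcal T\subseteq A\setminus\mathcal G$ is a distinguished set (tangible elements) containing a designated subset $\mathcal T^\circ$ (persistent elements) with $A^\times\subseteq\mathcal T^\circ$, such that: (NS1) $a\in\mathcal T^\circ$ implies $a^n\in\mathcal T^\circ$ for all $n\in\mathbb N$; (NS2) $a+b\in\mathcal T$ implies $a+b^\nu\notin\mathcal G$, unless $a+b$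 is redundant. It is tame if every $a\in A\setminus(\mathcal T\cup\mathcal G)$ can be written $a=c+d^\nu$ with $c,d\in\mathcal T$. A congruence $\mathfrak A$ on $A$ is an equivalence relation $\equiv$ respecting $+$ and $\cdot$, viewed as a subset of $A\times A$. Its ghost projection is $\mathsf G_{\rm cls}^{-1}(\mathfrak A)=\{a\mid a\equiv a^\nu\}$; its tangible projection is $\mathsf T_{\rm cls}^{-1}(\mathfrak A)=\{a\in\mathcal T\mid a\equiv t\text{ only for }t\in\mathcal T\}$. $\mathfrak A$ is a $\mathfrak q$-congruence if $A^\times\subseteq\mathsf T_{\rm cls}^{-1}(\mathfrak A)$; an $\ell$-congruence if moreover $\mathsf T_{\rm cls}^{-1}(\mathfrak A)$ is a multiplicative submonoid (of persistent elements); $\mathfrak g$-prime if it is an $\ell$-congruence such that $ab\equiv(ab)^\nu$ implies $a\equiv a^\nu$ or $b\equiv b^\nu$. $\operatorname{Spec}(A)$ is the set of all $\mathfrak g$-prime congruences; its Zariski topology has as closed sets the sets $\mathcal V(E)=\{\mathfrak P\in\operatorname{Spec}(A)\mid E\subseteq\mathsf G_{\rm cls}^{-1}(\mathfrak P)\}$, $E\subseteq A$. A nonempty topological space is irreducible if any decomposition $X=X_1\cup X_2$ into closed subsets has $X_1=X$ or $X_2=X$; a subset is irreducible if it is so in the induced topology. *)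

(* Defs.v *)
From HB Require Import structures.
From mathcomp Require Import all_boot all_order all_algebra.
From mathcomp Require Import all_classical.
From mathcomp Require Import topology.

Set Implicit Arguments.
Unset Strict Implicit.
Unset Printing Implicit Defensive.

Import GRing.Theory.
Local Open Scope classical_set_scope.
Local Open Scope ring_scope.

(* The order of the submonoid [ghost] is carried by a relation [gle] on all of
   M that is constrained only on ghosts.  [gle_add2r] is the compatibility
   with addition that makes [ghost] a partially ordered monoid. *)
HB.mixin Record isNuMonoid M & GRing.Nmodule M := {
  ghost : set M;
  gle : M -> M -> Prop;
  nu : M -> M;
  ghost0 : ghost 0;
  ghostD : forall a b, ghost a -> ghost b -> ghost (a + b);
  gle_refl : forall a, ghost a -> gle a a;
  gle_anti : forall a b, ghost a -> ghost b -> gle a b -> gle b a -> a = b;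
  gle_trans : forall a b c, ghost a -> ghost b -> ghost c ->
    gle a b -> gle b c -> gle a c;
  gle_add2r : forall a b c, ghost a -> ghost b -> ghost c ->
    gle a b -> gle (a + c) (b + c);
  ghost_pos : forall a, ghost a -> a <> 0 -> gle 0 a /\ 0 <> a;
  nu_morph : nmod_morphism nu;
  nu_idem : forall a, nu (nu a) = nu a;
  nu_range : range nu = ghost;
  nu_dom : forall a b : M, gle (nu b) (nu a) /\ nu b <> nu a -> a + b = a;
  nu_eq : forall a b : M, nu a = nu b -> a + b = nu a;
  nu_ghost : forall a b : M,
    ~ ghost (a + b) -> ghost (a + nu b) -> a + b = nu a + b
}.

#[short(type="nuMonoidType")]
HB.structure Definition NuMonoid := {M of GRing.Nmodule M & isNuMonoid M}.

Definition redundant (M : nuMonoidType) (a b : M) : Prop :=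
  a + b = a \/ a + b = b.

(* The group A^x of invertible elements; MathComp's [GRing.unit] is not
   available on semirings. *)
Definition invertible (A : comPzSemiRingType) : set A :=
  [set a | exists b, a * b = 1].

HB.mixin Record isNuSemiRing A & GRing.ComPzSemiRing A & NuMonoid A := {
  tangible : set A;
  persistent : set A;
  tangible_nghost : tangible `<=` ~` ghost;
  persistent_tangible : persistent `<=` tangible;
  invertible_persistent : @invertible A `<=` persistent;
  persistentX : forall (a : A) (n : nat), persistent a -> persistent (a ^+ n);
  tangible_add : forall a b : A,
    tangible (a + b) -> ~ redundant a b -> ~ ghost (a + nu b)
}.

#[short(type="comNuSemiRingType")]
HB.structure Definition ComNuSemiRing :=
  {A of GRing.ComPzSemiRing A & isNuMonoid A & isNuSemiRing A}.

Definition tame (A : comNuSemiRingType) : Prop :=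
  forall a : A, ~ tangible a -> ~ ghost a ->
    exists c d : A, [/\ tangible c, tangible d & a = c + nu d].

Section Congruences.
Variable A : comNuSemiRingType.
Implicit Types E : set (A * A).

Record congruence E : Prop := Congruence {
  congruence_refl : forall a, E (a, a);
  congruence_sym : forall a b, E (a, b) -> E (b, a);
  congruence_trans : forall a b c, E (a, b) -> E (b, c) -> E (a, c);
  congruenceD : forall a b c d, E (a, b) -> E (c, d) -> E (a + c, b + d);
  congruenceM : forall a b c d, E (a, b) -> E (c, d) -> E (a * c, b * d)
}.

Definition ghost_proj E : set A := [set a | E (a, nu a)].

Definition tangible_proj E : set A :=
  [set a | tangible a /\ forall t, E (a, t) -> tangible t].

Definition q_congruence E : Prop :=
  congruence E /\ @invertible A `<=` tangible_proj E.

Definition l_congruence E : Prop :=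
  [/\ q_congruence E,
      tangible_proj E `<=` persistent,
      tangible_proj E 1
    & forall a b, tangible_proj E a -> tangible_proj E b ->
        tangible_proj E (a * b)].

Definition g_prime E : Prop :=
  l_congruence E /\
  forall a b, E (a * b, nu (a * b)) -> E (a, nu a) \/ E (b, nu b).

Record Spec := MkSpec {
  spec_cong :> set (A * A);
  spec_gprime : g_prime spec_cong
}.

HB.instance Definition _ := gen_eqMixin Spec.
HB.instance Definition _ := gen_choiceMixin Spec.

(* V(D) for D a subset of A *)
Definition zeros (D : set A) : set Spec := [set P | D `<=` ghost_proj P].

Definition zariski_open : set_system Spec :=
  [set U | exists D, ~` U = zeros D].

Lemma nu_double (a : A) : a + a = nu a.
Proof. exact: nu_eq. Qed.

Lemma nuM (a b : A) : nu (a * b) = a * nu b.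
Proof. by rewrite -!nu_double mulrDr. Qed.

Lemma ghost_projM (P : Spec) (a b : A) :
  ghost_proj P a \/ ghost_proj P b <-> ghost_proj P (a * b).
Proof.
have [[[cP _] _ _ _] prP] := spec_gprime P; rewrite /ghost_proj /=; split; last exact: prP.
case=> h; last by rewrite nuM; apply: congruenceM => //; exact: congruence_refl.
rewrite mulrC nuM; apply: congruenceM => //; exact: congruence_refl.
Qed.

Lemma zariski_openT : zariski_open setT.
Proof.
exists [set: A]; apply/seteqP; split=> [P []//|P /= h _].
have [[[cP sub] _ [_ t1] _] _] := spec_gprime P.
have /t1 : (spec_cong P) (1, nu 1) by exact: h.
by move=> /tangible_nghost; apply; rewrite -nu_range; exists 1.
Qed.

Lemma zariski_openI : setI_closed zariski_open.
Proof.
move=> U V [D hD] [D' hD']; exists [set a | exists b c, [/\ D b, D' c & a = b * c]].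
rewrite setCI hD hD'; apply/seteqP; split=> P /=.
  move=> h a [b [c [Db Dc ->]]]; apply/ghost_projM.
  by case: h => h; [left|right]; exact: h.
move=> h; apply: contrapT => /not_orP[nD nD'].
apply: nD => b Db; apply: contrapT => nb; apply: nD' => c Dc.
have /ghost_projM[/nb|] // : ghost_proj P (b * c) by apply: h; exists b, c.
Qed.

Lemma zariski_open_bigcup (I : Type) (f : I -> set Spec) :
  (forall i, zariski_open (f i)) -> zariski_open (\bigcup_i f i).
Proof.
move=> /choice[D hD]; exists (\bigcup_i D i); rewrite setC_bigcup.
apply/seteqP; split=> P /= h.
  by move=> a [i _ Da]; have := h i Logic.I; rewrite hD; exact.
by move=> i _; rewrite hD => a Da; apply: h; exists i.
Qed.

HB.instance Definition _ := isOpenTopological.Build Spec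
  zariski_openT zariski_openI zariski_open_bigcup.

Lemma closed_zariski (Y : set Spec) : closed Y <-> exists D, Y = zeros D.
Proof. by rewrite -openC; split=> -[D h]; exists D; move: h; rewrite setCK. Qed.

Definition bigcap_cong (Y : set Spec) : set (A * A) :=
  \bigcap_(P in Y) (spec_cong P).

End Congruences.

Definition irreducible_space (T : topologicalType) : Prop :=
  [set: T] !=set0 /\
  forall X1 X2 : set T, closed X1 -> closed X2 -> X1 `|` X2 = [set: T] ->
    X1 = [set: T] \/ X2 = [set: T].

(* [set_type Y] carries the topology induced from T. *)
Definition irreducible_set (T : topologicalType) (Y : set T) : Prop :=
  irreducible_space (set_type Y).

(* Main.v *)
Require Import Defs.
From mathcomp Require Import all_boot all_algebra all_classical topology.

(** Both sides of the equivalence say that [Y] is nonempty and that a product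
    can be a ghost at all points of [Y] only if one of its factors is: call
    this property ghost primality of [Y].

    For irreducibility this is the usual argument ([irreducible_setE]): the
    closed sets are the zero loci, and a zero locus of a product is the union of
    the zero loci of its factors.

    For the congruence [bigcap_cong Y] the delicate point is its tangible
    projection, because the tangible projection of an intersection may a priori
    be larger than the union of the tangible projections.  Tameness removes the
    difficulty altogether: in any additive nu-monoid a sum [c + nu d] is either
    [c] or a ghost ([addr_nu]), so that in a tame semiring every element is
    tangible or a ghost.  Hence the tangible projection of an arbitrary
    congruence is exactly the complement of its ghost projection
    ([tangible_projE]).  Since the ghost projection of an intersection is the
    intersection of the ghost projections, all the conditions in the definition
    of a g-prime congruence become statements on ghosts, and they reduce to
    ghost primality of [Y] ([g_prime_bigcapE]). *)

Import GRing.Theory.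
Local Open Scope classical_set_scope.
Local Open Scope ring_scope.

Section NuMonoid.
Context {M : nuMonoidType}.
Implicit Types a b c d : M.

Lemma ghost_nu a : ghost (nu a).
Proof. by rewrite -nu_range; exists a. Qed.

Lemma nu_id a : ghost a -> nu a = a.
Proof. by rewrite -nu_range => -[b _ <-]; exact: nu_idem. Qed.

Lemma nuD a b : nu (a + b) = nu a + nu b.
Proof. by case: (nu_morph (s := M)) => _; exact. Qed.

Lemma gle_addr a b : ghost a -> ghost b -> gle a (a + b).
Proof.
move=> ga gb; case: (pselect (b = 0)) => [->|b0].
  by rewrite addr0; exact: gle_refl.
have /ghost_pos/(_ b0)[le0b _] := gb.
by have := gle_add2r 0 b a ghost0 gb ga le0b; rewrite add0r addrC.
Qed.

(** Put [t = c + nu d].  In any case [c + t = nu c + nu d] is a ghost.  If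
    [nu t] is strictly above [nu c], domination gives [c + t = t].  Otherwise
    [nu d] is below [nu c], so either [c] dominates [nu d] or the two have the
    same ghost value and their sum is that ghost. *)
Lemma addr_nu c d : c + nu d = c \/ ghost (c + nu d).
Proof.
case: (pselect (nu (c + nu d) = nu c)) => [e|ne]; last first.
  right.
  have <- : c + nu d + c = c + nu d.
    apply: nu_dom; split; last by move=> h; apply: ne.
    by rewrite nuD nu_idem; apply: gle_addr; exact: ghost_nu.
  rewrite addrAC (nu_eq c c erefl).
  by apply: ghostD; exact: ghost_nu.
case: (pselect (nu d = nu c)) => [dc|ndc].
  by right; rewrite nu_eq ?nu_idem//; exact: ghost_nu.
left; apply: nu_dom; rewrite nu_idem; split=> //.
rewrite -e nuD nu_idem addrC.
by apply: gle_addr; exact: ghost_nu.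
Qed.

End NuMonoid.

Lemma tame_tangible_or_ghost {A : comNuSemiRingType} (a : A) :
  tame A -> tangible a \/ ghost a.
Proof.
move=> hA; apply: contrapT => /not_orP[nt ng].
have [c [d [tc _ eqa]]] := hA a nt ng.
by case: (addr_nu c d); rewrite -eqa // => eqac; apply: nt; rewrite eqac.
Qed.

Section Congruence.
Context {A : comNuSemiRingType}.
Implicit Types (E : set (A * A)) (Y : set (Spec A)) (a b : A).

Lemma tangible_proj_nghost {E a} : tangible_proj E a -> ~ ghost_proj E a.
Proof. by move=> [_ tE] /tE/tangible_nghost; apply; exact: ghost_nu. Qed.

Lemma congruence_ghost_proj {E a b} :
  congruence E -> E (a, b) -> ghost b -> ghost_proj E a.
Proof.
move=> cE Eab gb; apply: (congruence_trans cE Eab).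
rewrite -{1}(nu_id _ gb) -!nu_double.
by apply: (congruenceD cE); exact: (congruence_sym cE).
Qed.

(** An element of a tame semiring that fails to be tangible is a ghost, and an
    element congruent to some ghost is congruent to its own ghost. *)
Lemma tangible_projE E a :
  tame A -> congruence E -> tangible_proj E a <-> ~ ghost_proj E a.
Proof.
move=> hA cE; split; first exact: tangible_proj_nghost.
move=> nga; suff tE t : E (a, t) -> tangible t.
  by split=> //; apply: tE; exact: (congruence_refl cE).
move=> Eat; have [//|gt] := tame_tangible_or_ghost t hA.
by case: nga; exact: congruence_ghost_proj cE Eat gt.
Qed.

Lemma spec_congruence (P : Spec A) : congruence (spec_cong P).
Proof. by have [[[]]] := spec_gprime P. Qed.

Lemma spec_invertible_nghost (P : Spec A) {a} : invertible a -> ~ ghost_proj P a.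
Proof.
by have [[[_ sub] _ _ _] _] := spec_gprime P => /sub/tangible_proj_nghost.
Qed.

Lemma invertible1 : invertible (1 : A).
Proof. by exists 1; rewrite mulr1. Qed.

Lemma bigcap_congruence Y : congruence (bigcap_cong Y).
Proof.
split.
- by move=> a P _; exact: congruence_refl (spec_congruence P) a.
- by move=> a b h P YP; apply: (congruence_sym (spec_congruence P)); exact: h.
- move=> a b c h k P YP.
  exact: (congruence_trans (spec_congruence P)) (h P YP) (k P YP).
- move=> a b c d h k P YP.
  exact: (congruenceD (spec_congruence P)) (h P YP) (k P YP).
- move=> a b c d h k P YP.
  exact: (congruenceM (spec_congruence P)) (h P YP) (k P YP).
Qed.

Lemma bigcap_nghost {Y a} :
  ~ ghost_proj (bigcap_cong Y) a -> exists2 P, Y P & ~ ghost_proj P a.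
Proof. by move=> nga; rewrite existsPNP => h; apply: nga => P; exact: h. Qed.

(** For a nonempty [Y], this says that the ghost projection of
    [bigcap_cong Y] is a prime ideal. *)
Definition ghost_prime_set Y : Prop :=
  Y !=set0 /\
  forall a b, ghost_proj (bigcap_cong Y) (a * b) ->
    ghost_proj (bigcap_cong Y) a \/ ghost_proj (bigcap_cong Y) b.

(** For nonemptiness: the empty intersection is the total congruence, under
    which [1] is a ghost.  Conversely, an element outside the ghost projection
    of the intersection is not a ghost at some point of [Y], hence it is
    tangible at that point, and there the tangible projection consists of
    persistent elements. *)
Lemma g_prime_bigcapE Y :
  tame A -> g_prime (bigcap_cong Y) <-> ghost_prime_set Y.
Proof.
move=> hA; have cK := bigcap_congruence Y.
split=> [[[_ _ t1 _] prK]|[[P YP] prK]].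
  split; last exact: prK.
  by have /bigcap_nghost[P YP _] := tangible_proj_nghost t1; exists P.
have unitK a : invertible a -> tangible_proj (bigcap_cong Y) a.
  move=> ua; apply/tangible_projE => // ga.
  exact: (spec_invertible_nghost P ua) (ga P YP).
split; last exact: prK.
split.
- by split.
- move=> a /tangible_proj_nghost/bigcap_nghost[Q _ nga].
  have [[_ sub _ _] _] := spec_gprime Q.
  by apply/sub/tangible_projE => //; exact: spec_congruence.
- exact: unitK invertible1.
- move=> a b /tangible_proj_nghost nga /tangible_proj_nghost ngb.
  by apply/tangible_projE => // /prK[].
Qed.

End Congruence.

Lemma irreducible_setP {T : topologicalType} {Y : set T} :
  irreducible_set Y <->
  Y !=set0 /\ forall C1 C2 : set T, closed C1 -> closed C2 ->
    Y `<=` C1 `|` C2 -> Y `<=` C1 \/ Y `<=` C2.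
Proof.
have traceT (C : set T) :
    set_val @^-1` C = [set: set_type Y] <-> Y `<=` C.
  split=> [CT y Yy|YC].
    suff : (set_val @^-1` C) (SigSub (mem_set Yy) : set_type Y) by [].
    by rewrite CT.
  by apply/seteqP; split=> // y _; apply: YC; exact: set_valP.
split=> [[[y _] irrY]|[[y Yy] irrY]].
  split; first by exists (set_val y); exact: set_valP.
  move=> C1 C2 cC1 cC2 /traceT YC.
  have closed_trace (C : set T) : closed C -> closed (set_val @^-1` C : set Y).
    by move: C; apply/continuous_closedP; exact: initial_continuous.
  have := irrY _ _ (closed_trace _ cC1) (closed_trace _ cC2) YC.
  by case=> /traceT; [left|right].
split; first by exists (SigSub (mem_set Yy)).
have closedE (X : set Y) :
    closed X -> exists2 C : set T, closed C & X = set_val @^-1` C.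
  rewrite -openC => -[U oU UX]; exists (~` U); first by rewrite closedC.
  by rewrite -[LHS]setCK -UX -preimage_setC.
move=> _ _ /closedE[C1 cC1 ->] /closedE[C2 cC2 ->].
rewrite -preimage_setU => /traceT/(irrY _ _ cC1 cC2).
by case=> /traceT; [left|right].
Qed.

Section Irreducible.
Context {A : comNuSemiRingType}.
Implicit Types (Y : set (Spec A)) (D : set A).

Lemma zeros_closed D : closed (zeros D).
Proof. by apply/closed_zariski; exists D. Qed.

Lemma nsubset_zeros {Y D} : ~ Y `<=` zeros D ->
  exists2 a, D a & ~ ghost_proj (bigcap_cong Y) a.
Proof.
move=> nYD; rewrite existsPNP => h; apply: nYD => P YP a Da.
exact: h a Da P YP.
Qed.

(** If [Y] is covered by the zero loci of [D1] and [D2] but contained in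
    neither, then some [a] in [D1] and [b] in [D2] are not ghosts on all of [Y]
    although [a * b] is.  Conversely, if [a * b] is a ghost on [Y], then [Y] is
    covered by the zero loci of [a] and [b]. *)
Lemma irreducible_setE Y : irreducible_set Y <-> ghost_prime_set Y.
Proof.
split=> [/irreducible_setP[Y0 irrY]|[Y0 prY]].
  split=> // a b gab.
  have cover : Y `<=` zeros [set a] `|` zeros [set b].
    move=> P YP; have /ghost_projM : ghost_proj P (a * b) by exact: gab.
    by case=> g; [left|right] => _ ->.
  by have [sub|sub] := irrY _ _ (zeros_closed _) (zeros_closed _) cover;
    [left|right] => P /sub; exact.
apply/irreducible_setP; split=> //.
move=> _ _ /closed_zariski[D1 ->] /closed_zariski[D2 ->] cover.
apply: contrapT => /not_orP[/nsubset_zeros[a Da nga] /nsubset_zeros[b Db ngb]].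
have /prY[] // : ghost_proj (bigcap_cong Y) (a * b).
move=> P YP; apply/ghost_projM.
by case: (cover P YP) => g; [left|right]; exact: g.
Qed.

End Irreducible.

Theorem theorem6p24 (A : comNuSemiRingType) (hA : tame A)
    (Y : set (Spec A)) (hY : closed Y) :
  irreducible_set Y <-> g_prime (bigcap_cong Y).
Proof. by rewrite irreducible_setE g_prime_bigcapE. Qed.
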